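(* There exists a family $\mathcal F_0$ of $3$ axis-parallel rectangles such that $\pi_L(\mathcal F_0)\ge \frac{36}{31}\,\pi(\mathcal F_0)$.
   Context: For a finite family $\mathcal F$ of closed axis-parallel rectangles in the plane, a point set $P\subset\mathbb R^2$ is $\mathcal F$-piercing if every translate of every rectangle in $\mathcal F$ contains a point of $P$. The density of a point set $P$ is $\limsup_{r\to\infty} |P\cap[-r,r]^2|/(2r)^2$. $\pi(\mathcal F)$ is the infimum of the densities of $\mathcal F$-piercing point sets, and $\pi_L(\mathcal F)$ is the infimum of the densities of $\mathcal F$-piercing lattices, where a lattice $\{iu+jv:i,j\in\mathbb Z\}$ ($u,v$ linearly independent) has density $1/|\det[u,v]|$. *)

(* Defs.v *)
From mathcomp Require Import all_boot all_order all_algebra.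
From mathcomp Require Import finmap.
From mathcomp Require Import all_classical all_reals ereal.
Set Implicit Arguments. Unset Strict Implicit. Unset Printing Implicit Defensive.
Import Order.TTheory GRing.Theory Num.Theory.
Local Open Scope classical_set_scope.
Local Open Scope ring_scope.

Section Piercing.
Variable R : realType.
Notation pt := (R * R)%type.

Definition closed_rect (a b c d : R) : set pt :=
  [set p | a <= p.1 <= c /\ b <= p.2 <= d].

Definition is_rect (A : set pt) : Prop :=
  exists a b c d : R, a < c /\ b < d /\ A = closed_rect a b c d.

Definition translate (A : set pt) (t : pt) : set pt :=
  [set (p.1 + t.1, p.2 + t.2) | p in A].

Definition piercing (F : set (set pt)) (P : set pt) : Prop :=
  forall A, F A -> forall t : pt, exists2 p, P p & translate A t p.

Definition ecard (A : set pt) : \bar R :=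
  if pselect (finite_set A) then ((#|` fset_set A|%fset)%:R)%:E else +oo%E.

Definition square (r : R) : set pt := closed_rect (- r) (- r) r r.

(* density = limsup_{r -> oo} |P cap [-r,r]^2| / (2r)^2 *)
Definition density (P : set pt) : \bar R :=
  ereal_inf [set ereal_sup [set (ecard (P `&` square r) * ((2 * r) ^+ 2)^-1%:E)%E
                             | r in [set r : R | M <= r]]
            | M in [set M : R | 0 < M]].

Definition lattice (u v : pt) : set pt :=
  [set p | exists i j : int, p = (i%:~R * u.1 + j%:~R * v.1, i%:~R * u.2 + j%:~R * v.2)].

Definition det2 (u v : pt) : R := u.1 * v.2 - u.2 * v.1.

Definition pi_dens (F : set (set pt)) : \bar R :=
  ereal_inf [set density P | P in [set P | piercing F P]].

(* pi_L(F): infimum of densities 1/|det[u,v]| of F-piercing lattices *)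
Definition piL_dens (F : set (set pt)) : \bar R :=
  ereal_inf [set ((`|det2 uv.1 uv.2|)^-1)%:E
            | uv in [set uv : pt * pt | det2 uv.1 uv.2 != 0 /\ piercing F (lattice uv.1 uv.2)]].

End Piercing.

(* Main.v *)
Require Import Defs.
From mathcomp Require Import all_boot all_order all_algebra finmap.
From mathcomp Require Import all_classical all_reals ereal.
From mathcomp Require Import zify ring lra.
Set Implicit Arguments. Unset Strict Implicit. Unset Printing Implicit Defensive.
Import Order.TTheory GRing.Theory Num.Theory.
Local Open Scope classical_set_scope.
Local Open Scope ring_scope.

(* The family consists of the boxes 1 x 6, 6 x 1 and 3 x 3.

   The points (m, n) of Z^2 with n = s(m) mod 6, where s is the permutation
   0, 2, 4, 1, 3, 5 of the residues mod 6, pierce it with density 1/6.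

   Let a lattice of cell area D > n - 1 + 1/n, where n >= 3, pierce the boxes
   1 x n and n x 1.  The former give a basis p, q, with p in the first and q in
   the fourth quadrant, of total width at most 1 and heights at most n; the
   latter give such a basis P, Q of total height at most 1 and widths at most n.
   As D > 1, P = a p + b q and Q = c p + d q with natural numbers such that
   a d - b c = 1.  By Cramer's rule a D, b D, c D and d D are the absolute
   determinants of mixed pairs, so that b D, c D <= n^2 and a D, d D <= n^2 + 1;
   also D <= max(a, b, c, d), because D is at most a mean of the widths of P and
   Q.  Thus the largest entry is n or n + 1, and a refined estimate excludes
   n + 1.

   For n = 6 and D > 31/6 this leaves eight matrices, all of which give lattices
   that miss a 3 x 3 box. *)

Section Lattice.
Variable R : realType.
Implicit Types p q u v z w : R * R.

Lemma int_combE p q (i j : int) :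
  p *~ i + q *~ j = (i%:~R * p.1 + j%:~R * q.1, i%:~R * p.2 + j%:~R * q.2).
Proof. by rewrite [LHS]surjective_pairing !raddfD !raddfMz !mulrzl. Qed.

Lemma nat_combE p q (m n : nat) :
  p *+ m + q *+ n = (m%:R * p.1 + n%:R * q.1, m%:R * p.2 + n%:R * q.2).
Proof. exact: (int_combE p q m n). Qed.

Lemma latticeP p q z :
  lattice p q z <-> exists i j : int, z = p *~ i + q *~ j.
Proof. by split=> -[i [j ->]]; exists i, j; rewrite int_combE. Qed.

Lemma lattice_genl p q : lattice p q p.
Proof. by exists 1, 0; rewrite -int_combE addr0. Qed.

Lemma lattice_genr p q : lattice p q q.
Proof. by exists 0, 1; rewrite -int_combE add0r. Qed.

Lemma lattice_comb p q z w (i j : int) :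
  lattice p q z -> lattice p q w -> lattice p q (z *~ i + w *~ j).
Proof.
move=> /latticeP[k [l ->]] /latticeP[m [n ->]]; apply/latticeP.
exists (k * i + m * j), (l * i + n * j).
by rewrite !mulrzDl !mulrzDr -!mulrzA addrACA.
Qed.

Lemma lattice_subset p q u v :
  lattice p q u -> lattice p q v -> lattice u v `<=` lattice p q.
Proof. by move=> Lu Lv z /latticeP[i [j ->]]; apply: lattice_comb. Qed.

Lemma lattice_unimodular p q (i j k l : int) : i * l - j * k = 1 ->
  lattice (p *~ i + q *~ j) (p *~ k + q *~ l) = lattice p q.
Proof.
move=> det1; set u := p *~ i + q *~ j; set v := p *~ k + q *~ l.
have pE : p = u *~ l + v *~ (- j).
  rewrite !mulrzDl -!mulrzA addrACA -!mulrzDr.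
  rewrite (_ : i * l + k * - j = 1); last by lia.
  by rewrite (_ : j * l + l * - j = 0) ?addr0 //; lia.
have qE : q = u *~ (- k) + v *~ i.
  rewrite !mulrzDl -!mulrzA addrACA -!mulrzDr.
  rewrite (_ : j * - k + l * i = 1); last by lia.
  by rewrite (_ : i * - k + k * i = 0) ?add0r //; lia.
apply/seteqP; split; apply: lattice_subset; apply/latticeP.
- by exists i, j.
- by exists k, l.
- by exists l, (- j).
- by exists (- k), i.
Qed.

Lemma det2_comb p q (i j k l : int) :
  det2 (p *~ i + q *~ j) (p *~ k + q *~ l) = (i * l - j * k)%:~R * det2 p q.
Proof. by rewrite !int_combE /det2 /= intrB !intrM; ring. Qed.

Lemma det2_combl p q (i j : int) :
  det2 (p *~ i + q *~ j) q = i%:~R * det2 p q.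
Proof. by rewrite int_combE /det2 /=; ring. Qed.

Lemma det2_combr p q (i j : int) :
  det2 p (p *~ i + q *~ j) = j%:~R * det2 p q.
Proof. by rewrite int_combE /det2 /=; ring. Qed.

Lemma det2_cramer p q z : det2 p q != 0 ->
  z = (det2 z q / det2 p q * p.1 + det2 p z / det2 p q * q.1,
       det2 z q / det2 p q * p.2 + det2 p z / det2 p q * q.2).
Proof.
rewrite /det2 => D0; rewrite [LHS]surjective_pairing.
by congr (_, _); field.
Qed.

Lemma lattice_det2_int p q z w : lattice p q z -> lattice p q w ->
  exists k : int, det2 z w = k%:~R * det2 p q.
Proof.
by move=> /latticeP[i [j ->]] /latticeP[k [l ->]]; eexists; apply: det2_comb.
Qed.

Lemma lattice_basis_of_det_lt p q u v :
  lattice p q u -> lattice p q v -> det2 u v != 0 ->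
  `|det2 u v| < 2 * `|det2 p q| -> lattice u v = lattice p q.
Proof.
move=> Lu Lv uv0 uv_lt; have [k uvE] := lattice_det2_int Lu Lv.
move: uv0 uv_lt; rewrite uvE mulf_eq0 negb_or intr_eq0 => /andP[k0 pq0].
rewrite normrM -intr_norm ltr_pM2r ?normr_gt0 // (ltr_int R _ 2) => k2.
have kk : k * k = 1 by nia.
have ratio z w : lattice p q z -> lattice p q w ->
    exists m : int, det2 z w / det2 u v = m%:~R.
  move=> Lz Lw; have [m zwE] := lattice_det2_int Lz Lw; exists (m * k).
  rewrite zwE -{1}[m]mulr1 -kk mulrA intrM -mulrA -uvE mulfK //.
  by rewrite uvE mulf_neq0 // intr_eq0.
apply/seteqP; split=> [|z Lz]; first exact: lattice_subset.
have [i iE] := ratio _ _ Lz Lv; have [j jE] := ratio _ _ Lu Lz.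
exists i, j; rewrite -iE -jE; apply: det2_cramer.
by rewrite uvE mulf_neq0 // intr_eq0.
Qed.

Lemma lattice_norm_det2 p q u v :
  lattice u v = lattice p q -> `|det2 u v| = `|det2 p q|.
Proof.
move=> uvE; have [Lu Lv] : lattice p q u /\ lattice p q v.
  by rewrite -uvE; split; [exact: lattice_genl|exact: lattice_genr].
have [Lp Lq] : lattice u v p /\ lattice u v q.
  by rewrite uvE; split; [exact: lattice_genl|exact: lattice_genr].
have [k kE] := lattice_det2_int Lu Lv; have [l lE] := lattice_det2_int Lp Lq.
have [pq0|pq0] := eqVneq (det2 p q) 0; first by rewrite kE pq0 mulr0.
have kl : k * l = 1.
  apply: (@intr_inj R); apply: (mulIf pq0).
  by rewrite mul1r [RHS]lE kE intrM; ring.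
have /eqP := congr1 absz kl; rewrite abszM muln_eq1 => /andP[/eqP k1 _].
by rewrite kE normrM -intr_norm -abszE k1 mul1r.
Qed.

Lemma norm_det2_le (r : R) z w :
  square r z -> `|det2 z w| <= r * (`|w.1| + `|w.2|).
Proof.
move=> [/= z1 z2]; rewrite -ler_norml in z1; rewrite -ler_norml in z2.
apply: le_trans (ler_normB _ _) _; rewrite !normrM addrC mulrDr.
by apply: lerD; apply: ler_wpM2r.
Qed.

Lemma finite_int_ball (c : R) : finite_set [set i : int | `|i%:~R| <= c].
Proof.
pose N := Num.bound c.
apply: (@sub_finite_set _ _ [set k%:Z - N%:Z | k in `I_(2 * N).+1]).
  move=> i /= ic; have : `|i|%:~R < N%:~R :> R.
    by rewrite intr_norm (le_lt_trans ic) // archi_boundP // (le_trans _ ic).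
  by rewrite ltr_int => iN; exists (absz (i + N%:Z)%R) => /=; lia.
exact: finite_image.
Qed.

Definition locally_finite (L : set (R * R)) : Prop :=
  forall r : R, finite_set (L `&` square r).

Lemma lattice_locally_finite p q :
  det2 p q != 0 -> locally_finite (lattice p q).
Proof.
move=> D0 r; pose c w := r * (`|w.1| + `|w.2|) / `|det2 p q|.
pose A w := [set i : int | `|i%:~R| <= c w].
apply: (@sub_finite_set _ _ [set p *~ i + q *~ j | i in A q & j in A p]).
  move=> _ [/latticeP[i [j ->]] sq]; exists i; [|exists j => //];
    rewrite /A /c /= ler_pdivlMr ?normr_gt0 // -normrM.
    by rewrite -(det2_combl p q i j); apply: norm_det2_le.
  rewrite -(det2_combr p q i j) (_ : det2 p _ = - det2 (p *~ i + q *~ j) p).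
    by rewrite normrN; apply: norm_det2_le.
  by rewrite /det2; ring.
by apply: finite_image2; apply: finite_int_ball.
Qed.

End Lattice.

Lemma finite_set_argmin d (V : orderType d) (T : choiceType) (A : set T)
    (F : T -> V) : finite_set A -> A !=set0 ->
  exists2 z, A z & forall w, A w -> (F z <= F w)%O.
Proof.
move=> /finite_seqP[s ->] [z0 z0s].
have [z _ zmin] := arg_minP (fun w : seq_sub s => F (val w))
  (isT : xpredT (SeqSub z0s)).
by exists (val z) => [|w ws]; [exact: ssvalP|exact: (zmin (SeqSub ws))].
Qed.

Section EmptyBoxes.
Variable R : realType.
Implicit Types (L : set (R * R)) (a b : R) (p q z : R * R).

Definition pierces_box L a b : Prop :=
  forall t, exists2 z, L z & t.1 <= z.1 <= t.1 + a /\ t.2 <= z.2 <= t.2 + b.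

Lemma locally_finite_rect L (a b c d : R) :
  locally_finite L -> finite_set (L `&` closed_rect a b c d).
Proof.
move=> fin; pose r := `|a| + `|b| + `|c| + `|d|.
apply: sub_finite_set (fin r) => z [Lz [/= z1 z2]]; split=> //; rewrite /square.
have := ler_norm a; have := ler_norm b; have := ler_norm c; have := ler_norm d.
have := ler_norm (- a); have := ler_norm (- b); rewrite !normrN.
have := normr_ge0 a; have := normr_ge0 b; have := normr_ge0 c.
by have := normr_ge0 d; rewrite /r; split; rewrite /=; lra.
Qed.

(* Of the points in the strip one unit wider, the leftmost one must lie in the
   half-open box: a box between [t] and it would otherwise be missed. *)
Lemma pierces_half_open_box L a b t :
  locally_finite L -> pierces_box L a b ->
  exists2 z, L z & t.1 < z.1 <= t.1 + a /\ t.2 <= z.2 <= t.2 + b.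
Proof.
move=> fin pierced; pose A := L `&` closed_rect t.1 t.2 (t.1 + 1 + a) (t.2 + b)
  `&` [set z | t.1 < z.1].
have : A !=set0.
  have [z Lz [/= z1 z2]] := pierced (t.1 + 1, t.2).
  by exists z; split; [split=> //; split|]; rewrite /=; lra.
case/(finite_set_argmin fst) => [|z [[Lz [z1 z2]] tz] zmin].
  exact/finite_setIl/locally_finite_rect.
exists z => //; split=> //; rewrite tz leNgt; apply/negP => az.
have [w Lw [/= w1 w2]] := pierced ((z.1 + t.1 - a) / 2, t.2).
suff /zmin : A w by lra.
by split; [split=> //; split|]; rewrite /=; lra.
Qed.

(* [p] is the lowest point of the strip [0 < z.1 <= a] above the axis, [q] the
   highest one below; a box strictly between them would be missed. *)
Lemma pierces_box_adjacent L a b : 0 < b ->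
  locally_finite L -> pierces_box L a b ->
  exists p q, [/\ L p, L q, 0 < p.1 <= a, 0 < q.1 <= a &
                  [/\ 0 <= p.2, q.2 < 0 & p.2 - q.2 <= b]].
Proof.
move=> b0 fin pierced.
have window c : exists2 z, L z & 0 < z.1 <= a /\ c <= z.2 <= c + b.
  by have := pierces_half_open_box (0, c) fin pierced; rewrite /= add0r.
pose up := [set z | L z /\ (0 < z.1 <= a) /\ (0 <= z.2 <= b)].
pose down := [set z | L z /\ (0 < z.1 <= a) /\ (- (b + 1) <= z.2 < 0)].
have finite_strip (A : set (R * R)) : A `<=` L ->
    (forall z, A z -> 0 < z.1 <= a /\ - (b + 1) <= z.2 <= b) -> finite_set A.
  move=> AL Aab.
  apply: sub_finite_set (locally_finite_rect 0 (- (b + 1)) a b fin).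
  by move=> z Az; have [z1 z2] := Aab z Az; split; [exact: AL|split; lra].
have [p [Lp [p1 p2]] pmin] : exists2 p, up p & forall z, up z -> p.2 <= z.2.
  apply: finite_set_argmin; first by apply: finite_strip => z [] //; lra.
  by have [z Lz [z1 z2]] := window 0; exists z; split=> //; lra.
have [q [Lq [q1 q2]] qmax] :
    exists2 q, down q & forall z, down z -> - q.2 <= - z.2.
  apply: (finite_set_argmin (fun z => - z.2)).
    by apply: finite_strip => z [] //; lra.
  by have [z Lz [z1 z2]] := window (- (b + 1)); exists z; split=> //; lra.
exists p, q; split=> //; split; [lra..|]; rewrite leNgt; apply/negP => gap.
have [z Lz [z1 z2]] := window ((p.2 + q.2 - b) / 2).
have [z0|z0] := leP 0 z.2.
- by suff /pmin : up z by [lra]; split=> //; lra.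
- by suff /qmax : down z by [lra]; split=> //; lra.
Qed.

End EmptyBoxes.

Section Straddling.
Variable R : realType.
Implicit Types (a b : R) (p q u v z : R * R).

Definition straddling p q : Prop :=
  [/\ 0 <= p.1, 0 <= q.1, 0 <= p.2 & q.2 <= 0].

Lemma det2_straddling p q : straddling p q -> det2 p q <= 0.
Proof.
case=> p1 q1 p2 q2; rewrite /det2 subr_le0.
by apply: (@le_trans _ _ 0); [exact: mulr_ge0_le0|exact: mulr_ge0].
Qed.

(* In the open box with [0] and [p + q] on its vertical and [p] and [q] on its
   horizontal sides there is no point [i p + j q]: each of the four cases
   [i <= 0] or [1 <= i], [j <= 0] or [1 <= j] puts it beyond another side. *)
Lemma straddling_box_le p q a b : straddling p q ->
  pierces_box (lattice p q) a b -> p.1 + q.1 <= a \/ p.2 - q.2 <= b.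
Proof.
have int_cmp (k : int) : k%:~R <= 0 :> R \/ 1 <= k%:~R :> R.
  by have [?|?] := leP k 0; [left; rewrite lerz0|right; rewrite ler1z; lia].
case=> p1 q1 p2 q2 pierced; apply/orP; rewrite !leNgt -negb_and.
apply/negP => /andP[wide tall].
have [z [i [j ->]] /= [/andP[l1 r1] /andP[l2 r2]]] :=
  pierced ((p.1 + q.1 - a) / 2, (p.2 + q.2 - b) / 2).
by have [i1|i1] := int_cmp i; have [j1|j1] := int_cmp j; nra.
Qed.

Definition flat_pair a b p q : Prop :=
  [/\ straddling p q, p.1 <= a, q.1 <= a & p.2 - q.2 <= b].

Definition narrow_pair a b p q : Prop :=
  [/\ straddling p q, p.1 + q.1 <= a, p.2 <= b & - q.2 <= b].

Lemma wsum_le_max (x y s t : R) : 0 <= s -> 0 <= t ->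
  s * x + t * y <= (s + t) * Num.max x y.
Proof.
move=> s0 t0; rewrite mulrDl.
by apply: lerD; apply: ler_wpM2l => //; rewrite le_max lexx ?orbT.
Qed.

Lemma flat_pair_norm_det2_le a b p q : flat_pair a b p q ->
  `|det2 p q| <= b * Num.max p.1 q.1.
Proof.
case=> pq p1a q1a pqb; rewrite ler0_norm ?det2_straddling //.
case: pq => p1 q1 p2 q2; rewrite -oppr_ge0 in q2.
have max0 : 0 <= Num.max p.1 q.1 by rewrite le_max p1.
apply: le_trans (ler_wpM2r max0 pqb); rewrite /det2.
by have := wsum_le_max q.1 p.1 p2 q2; rewrite maxC; lra.
Qed.

Lemma narrow_pair_norm_det2_le a b p q : narrow_pair a b p q ->
  `|det2 p q| <= a * Num.max p.2 (- q.2).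
Proof.
case=> pq pqa p2b q2b; rewrite ler0_norm ?det2_straddling //.
case: pq => p1 q1 p2 q2.
have max0 : 0 <= Num.max p.2 (- q.2) by rewrite le_max p2.
apply: le_trans (ler_wpM2r max0 pqa); rewrite /det2.
by have := wsum_le_max (- q.2) p.2 p1 q1; rewrite maxC; lra.
Qed.

Section LatticeBasis.
Variables (u v : R * R) (a b : R).
Hypotheses (a_gt0 : 0 < a) (b_gt0 : 0 < b) (ab_lt : a * b < 2 * `|det2 u v|).
Hypothesis pierced : pierces_box (lattice u v) a b.

Lemma lattice_adjacent_basis : exists p q, lattice p q = lattice u v /\
  [/\ 0 < p.1 <= a, 0 < q.1 <= a & [/\ 0 <= p.2, q.2 < 0 & p.2 - q.2 <= b]].
Proof.
have uv0 : det2 u v != 0.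
  rewrite -normr_gt0 -(pmulr_rgt0 _ (ltr0Sn R 1)).
  by apply: lt_trans ab_lt; apply: mulr_gt0.
have [p [q [Lp Lq p1 q1 [p2 q2 pq2]]]] := pierces_box_adjacent b_gt0
  (lattice_locally_finite uv0) pierced.
exists p, q; split; last by split.
have flat : flat_pair a b p q by split; [split|..]; lra.
apply: lattice_basis_of_det_lt => //.
  rewrite lt_eqF // /det2 subr_lt0.
  have p1q2 : p.1 * q.2 < 0 by rewrite nmulr_llt0 //; lra.
  by apply: lt_le_trans p1q2 _; rewrite mulr_ge0 //; lra.
apply: le_lt_trans ab_lt; apply: le_trans (flat_pair_norm_det2_le flat) _.
by rewrite mulrC ler_wpM2r ?(ltW b_gt0) // ge_max; lra.
Qed.

Lemma lattice_flat_basis :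
  exists p q, lattice p q = lattice u v /\ flat_pair a b p q.
Proof.
have [p [q [Lpq [p1 q1 [p2 q2 pq2]]]]] := lattice_adjacent_basis.
by exists p, q; split=> //; split; [split|..]; lra.
Qed.

Lemma lattice_narrow_basis :
  exists p q, lattice p q = lattice u v /\ narrow_pair a b p q.
Proof.
have [p [q [Lpq [p1 q1 [p2 q2 pq2]]]]] := lattice_adjacent_basis.
have [pq|qp] := leP q.1 p.1.
- exists (p - q), q; split; last by split; [split|..]; rewrite /=; lra.
  have := @lattice_unimodular _ p q 1 (- 1) 0 1.
  by rewrite mulr0z mulrN1z !mulr1z add0r => -> //; lia.
- exists p, (q - p); split; last by split; [split|..]; rewrite /=; lra.
  have := @lattice_unimodular _ p q 1 0 (- 1) 1.
  by rewrite mulr0z mulrN1z !mulr1z [p + 0]addr0 [- p + q]addrC => -> //; lia.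
Qed.

End LatticeBasis.

Lemma lattice_nat_comb p q z : lattice p q z ->
  det2 z q < - det2 p q -> det2 p z < - det2 p q -> det2 p q < 0 ->
  exists m n : nat, z = p *+ m + q *+ n.
Proof.
move=> /latticeP[i [j ->]]; rewrite det2_combl det2_combr => iD jD D0.
have ge0 (k : int) : k%:~R * det2 p q < - det2 p q -> 0 <= k.
  by rewrite -mulN1r ltr_nM2r // -[- 1]mulrN1z ltr_int; lia.
by exists (absz i), (absz j); rewrite !pmulrn !gez0_abs ?ge0.
Qed.

End Straddling.

(* Modulo [n + 1], the right-hand product is [b * c], hence [- 1]. *)
Lemma prod_complement_ge (n b c : nat) : (b <= n)%N -> (c <= n)%N ->
  (n.+1 %| (b * c).+1)%N -> (n <= (n.+1 - b) * (n.+1 - c))%N.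
Proof.
move=> bn cn bc; have dvd : (n.+1 %| ((n.+1 - b) * (n.+1 - c)).+1)%N.
  have : (n.+1 %| ((n.+1 - b) * (n.+1 - c)).+1 + n.+1 * (b + c))%N.
    have -> : (((n.+1 - b) * (n.+1 - c)).+1 + n.+1 * (b + c) =
               (b * c).+1 + n.+1 * n.+1)%N by nia.
    by rewrite dvdn_addl // dvdn_mulr.
  by rewrite dvdn_addl // dvdn_mulr.
exact: (dvdn_leq _ dvd).
Qed.

Section BilinearBound.
Variable R : realType.
Implicit Types n s t x y u v : R.

(* The bounds are the values at the vertices [(n, 1)] and [(0, n + 1)]. *)
Lemma linear_le_vertices n x y u v : 0 <= v -> 0 <= u -> 0 <= x -> 0 <= y ->
  x <= n -> x + y <= n + 1 ->
  v * x + u * y <= n * v + u \/ v * x + u * y <= (n + 1) * u.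
Proof.
move=> v0 u0 x0 y0 xn xy; have [uv|vu] := leP u v; [left|right].
- have : 0 <= (v - u) * (n - x) by rewrite mulr_ge0 ?subr_ge0.
  have : 0 <= u * (n + 1 - (x + y)) by rewrite mulr_ge0 ?subr_ge0.
  by lra.
- have : 0 <= (u - v) * x by rewrite mulr_ge0 ?subr_ge0 // ltW.
  have : 0 <= u * (n + 1 - (x + y)) by rewrite mulr_ge0 ?subr_ge0.
  lra.
Qed.

Lemma bilinear_bound n s t x y u v :
  3 <= n -> 0 <= s -> 0 <= t -> n <= s * t ->
  0 <= x -> 0 <= y -> 0 <= u -> 0 <= v ->
  x <= n -> x + s * y <= n + 1 -> v <= n -> v + t * u <= n + 1 ->
  x * v + y * u <= n ^+ 2 + n^-1.
Proof.
move=> n3 s0 t0 st x0 y0 u0 v0 xn xy vn vu.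
have [n_gt0 n0] : 0 < n /\ 0 <= n by lra.
have [sy0 tu0] := (mulr_ge0 s0 y0, mulr_ge0 t0 u0).
have nyu : n * (y * u) <= (t * u) * (s * y).
  by rewrite mulrACA [t * s]mulrC [u * y]mulrC ler_wpM2r ?mulr_ge0.
have nn : 3 * n <= n * n by apply: ler_wpM2r => //; lra.
have nnn : 3 * (n * n) <= n * (n * n) by apply: ler_wpM2r => //; lra.
suff : n * (x * v) + (t * u) * (s * y) <= n * n ^+ 2 + 1.
  by move=> le_n3; rewrite -(ler_pM2l n_gt0) !mulrDr divff ?lt0r_neq0 //; lra.
have [nv0 nn0] := (mulr_ge0 n0 v0, mulr_ge0 n0 n0).
rewrite expr2; have [le_xy|le_xy] := linear_le_vertices nv0 tu0 x0 sy0 xn xy.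
- by have [le_vu|le_vu] := linear_le_vertices nn0 ler01 v0 tu0 vn vu; lra.
- have : (n + 1) * (t * u) <= (n + 1) * (n + 1) by apply: ler_wpM2l; lra.
  lra.
Qed.

End BilinearBound.

Section BaseChange.
Variable R : realType.
Implicit Types (p q P Q : R * R) (a b c d : nat).

Definition base_change p q P Q a b c d : Prop :=
  [/\ P = p *+ a + q *+ b, Q = p *+ c + q *+ d & (a * d = b * c + 1)%N].

Lemma base_change_natr p q P Q a b c d : base_change p q P Q a b c d ->
  a%:R * d%:R = b%:R * c%:R + 1 :> R.
Proof. by case=> _ _ det1; rewrite -!natrM det1 natrD. Qed.

Lemma narrow_flat_base_change (h : R) p q P Q :
  narrow_pair 1 h p q -> flat_pair h 1 P Q -> lattice P Q = lattice p q ->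
  1 < - det2 p q -> exists a b c d, base_change p q P Q a b c d.
Proof.
move=> [pq pq1 _ _] [PQ _ _ PQ2] LPQ D1.
have LP : lattice p q P by rewrite -LPQ; apply: lattice_genl.
have LQ : lattice p q Q by rewrite -LPQ; apply: lattice_genr.
have D0 : det2 p q < 0 by lra.
have := det2_straddling pq; have := det2_straddling PQ.
case: pq PQ => p1 q1 p2 q2 [P1 Q1 P2 Q2] PQ_le0 pq_le0.
have [a [b PE]] : exists a b : nat, P = p *+ a + q *+ b.
  apply: lattice_nat_comb => //; apply: le_lt_trans D1; rewrite /det2.
    by have := mulr_ge0_le0 P1 q2; have := mulr_ge0 P2 q1; lra.
  have : p.1 * P.2 <= 1 * 1 by apply: ler_pM => //; lra.
  by have := mulr_ge0 p2 P1; lra.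
have [c [d QE]] : exists c d : nat, Q = p *+ c + q *+ d.
  apply: lattice_nat_comb => //; apply: le_lt_trans D1; rewrite /det2.
    have : - Q.2 * q.1 <= 1 * 1 by apply: ler_pM => //; lra.
    by have := mulr_ge0_le0 Q1 q2; lra.
  by have := mulr_ge0_le0 p1 Q2; have := mulr_ge0 p2 Q1; lra.
exists a, b, c, d; split=> //.
have pq0 : det2 p q != 0 by rewrite lt_eqF.
have det1 : a%:R * d%:R - b%:R * c%:R = 1 :> R.
  apply: (mulIf pq0); rewrite mul1r; apply: oppr_inj.
  rewrite -[in RHS]ler0_norm // -(lattice_norm_det2 LPQ) ler0_norm // PE QE.
  by rewrite (det2_comb p q a b c d) intrB !intrM.
by apply/eqP; rewrite -(eqr_nat R) natrD !natrM; apply/eqP; lra.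
Qed.

Section Entries.
Variables (p q P Q : R * R) (a b c d : nat).
Hypothesis change : base_change p q P Q a b c d.

Lemma base_change_coords :
  [/\ P.1 = a%:R * p.1 + b%:R * q.1, Q.1 = c%:R * p.1 + d%:R * q.1,
      p.2 = d%:R * P.2 - b%:R * Q.2 & - q.2 = c%:R * P.2 - a%:R * Q.2].
Proof.
have := base_change_natr change.
case: change => -> -> _ det1; rewrite !nat_combE /=; split=> //.
- by have := congr1 ( *%R^~ p.2) det1; rewrite /=; lra.
- by have := congr1 ( *%R^~ q.2) det1; rewrite /=; lra.
Qed.

Lemma base_change_cramer :
  [/\ det2 P q = a%:R * det2 p q, det2 p P = b%:R * det2 p q,
      det2 Q q = c%:R * det2 p q, det2 p Q = d%:R * det2 p q &
      det2 P Q = det2 p q].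
Proof.
have det1 := base_change_natr change; case: change => -> -> _.
rewrite (det2_combl p q a b) (det2_combr p q a b) (det2_combl p q c d).
rewrite (det2_combr p q c d) (det2_comb p q a b c d) intrB !intrM -!pmulrn.
by split=> //; rewrite det1 addrAC subrr add0r mul1r.
Qed.

Variable n : nat.
Hypotheses (n_gt2 : (2 < n)%N).
Hypotheses (narrow : narrow_pair 1 n%:R p q) (flat : flat_pair n%:R 1 P Q).
Let D := - det2 p q.

Lemma offdiag_entry_mul_le : b%:R * D <= n%:R ^+ 2 /\ c%:R * D <= n%:R ^+ 2.
Proof.
case: base_change_cramer => _ bE cE _ _; rewrite /D !mulrN -bE -cE /det2 expr2.
case: narrow flat => [[p1 q1 p2 q2] pq1 p2n q2n] [[P1 Q1 P2 Q2] P1n Q1n PQ2].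
split.
- have := ler_pM P1 p2 P1n p2n; have := mulr_ge0 p1 P2; lra.
- have : Q.1 * - q.2 <= n%:R * n%:R by apply: ler_pM => //; lra.
  by have := mulr_ge0_le0 q1 Q2; lra.
Qed.

Lemma diag_entry_mul_le :
  a%:R * D <= n%:R ^+ 2 + 1 /\ d%:R * D <= n%:R ^+ 2 + 1.
Proof.
case: base_change_cramer => aE _ _ dE _; rewrite /D !mulrN -aE -dE /det2 expr2.
case: narrow flat => [[p1 q1 p2 q2] pq1 p2n q2n] [[P1 Q1 P2 Q2] P1n Q1n PQ2].
split.
- have : P.1 * - q.2 <= n%:R * n%:R by apply: ler_pM => //; lra.
  have : P.2 * q.1 <= 1 * 1 by apply: ler_pM => //; lra.
  lra.
- have : Q.1 * p.2 <= n%:R * n%:R by apply: ler_pM.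
  have : - Q.2 * p.1 <= 1 * 1 by apply: ler_pM => //; lra.
  lra.
Qed.

Lemma diag_succ_mul_le : (b <= n)%N -> (c <= n)%N -> a = n.+1 \/ d = n.+1 ->
  n.+1%:R * D <= n%:R ^+ 2 + n%:R^-1.
Proof.
move=> bn cn ad; have nst : (n <= (n.+1 - b) * (n.+1 - c))%N.
  apply: prod_complement_ge => //; case: change => _ _ ad_bc.
  rewrite -[(b * c).+1]addn1 -ad_bc.
  by case: ad => ->; [exact: dvdn_mulr|exact: dvdn_mull].
have n3 : 3 <= n%:R :> R by rewrite (ler_nat R 3).
have st : n%:R <= (n.+1 - b)%:R * (n.+1 - c)%:R :> R by rewrite -natrM ler_nat.
have sE : (n.+1 - b)%:R = n%:R + 1 - b%:R :> R by rewrite natrB ?natr1 // ltnW.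
have tE : (n.+1 - c)%:R = n%:R + 1 - c%:R :> R by rewrite natrB ?natr1 // ltnW.
have [P1E Q1E p2E q2E] := base_change_coords.
have [aE _ _ dE _] := base_change_cramer.
case: narrow flat => [[p1 q1 p2 q2] pq1 p2n q2n] [[P1 Q1 P2 Q2] P1n Q1n PQ2].
rewrite -oppr_ge0 in q2; rewrite -oppr_ge0 in Q2.
have succ_mul x : x <= 1 -> (n%:R + 1) * x <= n%:R + 1 :> R.
  by move=> x1; rewrite ler_piMr //; lra.
case: ad => adE; rewrite -adE /D mulrN -?aE -?dE /det2.
- have -> : - (P.1 * q.2 - P.2 * q.1) = P.1 * - q.2 + q.1 * P.2 by ring.
  rewrite adE -natr1 in P1E q2E.
  apply: (bilinear_bound n3 _ _ st) => //; rewrite ?sE ?tE.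
  + by have := succ_mul _ pq1; lra.
  + by have := succ_mul _ PQ2; lra.
- have -> : - (p.1 * Q.2 - p.2 * Q.1) = p.2 * Q.1 + - Q.2 * p.1 by ring.
  rewrite adE -natr1 in Q1E p2E.
  apply: (bilinear_bound n3 _ _ st) => //; rewrite ?sE ?tE.
  + by have := succ_mul _ PQ2; lra.
  + by have := succ_mul _ pq1; lra.
Qed.

Lemma small_entries_det_le (m : nat) :
  (maxn (maxn a b) (maxn c d) <= m)%N -> D <= m%:R.
Proof.
rewrite !geq_max => /andP[/andP[am bm] /andP[cm dm]].
have [P1E Q1E _ _] := base_change_coords.
have [_ _ _ _ PQ_pq] := base_change_cramer.
case: narrow => -[p1 q1 _ _] pq1 _ _.
have comb_le (k l : nat) : (k <= m)%N -> (l <= m)%N ->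
    k%:R * p.1 + l%:R * q.1 <= m%:R.
  move=> km lm; apply: (@le_trans _ _ (m%:R * (p.1 + q.1))).
    by rewrite mulrDr lerD // ler_wpM2r // ler_nat.
  by rewrite ler_piMr.
apply: le_trans (_ : Num.max P.1 Q.1 <= _).
  rewrite /D -PQ_pq -ler0_norm; last by apply: det2_straddling; case: flat.
  by rewrite -[Num.max _ _]mul1r; apply: flat_pair_norm_det2_le flat.
by rewrite ge_max P1E Q1E !comb_le.
Qed.

Lemma mul_det_gt : n%:R - 1 + n%:R^-1 < D ->
  n%:R ^+ 2 - n%:R + 1 < n%:R * D.
Proof.
have n0 : 0 < n%:R :> R by rewrite ltr0n; apply: ltn_trans n_gt2.
rewrite -(ltr_pM2l n0) !mulrDr divff ?lt0r_neq0 // expr2; lra.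
Qed.

Lemma largest_entry_le : n%:R - 1 + n%:R^-1 < D ->
  (maxn (maxn a b) (maxn c d) <= n)%N.
Proof.
move=> /mul_det_gt nD; have n3 : 3 <= n%:R :> R by rewrite (ler_nat R 3).
have D0 : 0 <= D by rewrite oppr_ge0; case: narrow => /det2_straddling.
have mulD_le (k l : nat) (x : R) : (k <= l)%N -> l%:R * D <= x -> k%:R * D <= x.
  by move=> kl; apply: le_trans; apply: ler_wpM2r; rewrite ?ler_nat.
have [bD cD] := offdiag_entry_mul_le; have [aD dD] := diag_entry_mul_le.
have offdiag_le (k : nat) : k%:R * D <= n%:R ^+ 2 -> (k <= n)%N.
  move=> kD; rewrite leqNgt; apply/negP => /mulD_le/(_ kD).
  by rewrite -natr1; nra.
have diag_le (k : nat) : k%:R * D <= n%:R ^+ 2 + 1 -> (k <= n.+1)%N.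
  move=> kD; rewrite leqNgt; apply/negP => /mulD_le/(_ kD).
  by rewrite -!natr1; nra.
have not_succ : ~ (a = n.+1 \/ d = n.+1).
  move=> /(diag_succ_mul_le (offdiag_le _ bD) (offdiag_le _ cD)) succD.
  have n0 : 0 < n%:R :> R by lra.
  have := ler_wpM2l (ltW n0) succD.
  by rewrite mulrDr divff ?lt0r_neq0 // -natr1; nra.
move: (offdiag_le _ bD) (offdiag_le _ cD) (diag_le _ aD) (diag_le _ dD).
by move: not_succ; clear; lia.
Qed.

Lemma largest_entry : n%:R - 1 + n%:R^-1 < D ->
  maxn (maxn a b) (maxn c d) = n.
Proof.
move=> large; apply/eqP; rewrite eqn_leq largest_entry_le //= leqNgt.
apply/negP => small.
have : D <= n.-1%:R.
  by apply: small_entries_det_le; rewrite -ltnS (ltn_predK n_gt2).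
have : 0 <= n%:R^-1 :> R by [].
by rewrite -subn1 natrB; [lra|apply: ltn_trans n_gt2].
Qed.

End Entries.
End BaseChange.

Definition unimodular_max6 : seq (nat * nat * nat * nat) :=
  [:: (1, 6, 0, 1); (5, 6, 4, 5); (1, 0, 6, 1); (5, 4, 6, 5);
      (6, 1, 5, 1); (6, 5, 1, 1); (1, 5, 1, 6); (1, 1, 5, 6)]%N.

Lemma mem_unimodular_max6 (a b c d : nat) : (a * d = b * c + 1)%N ->
  maxn (maxn a b) (maxn c d) = 6%N -> (a, b, c, d) \in unimodular_max6.
Proof.
pose r := iota 0 7; have enumerated : all (fun a => all (fun b => all (fun c =>
  all (fun d => (a * d == b * c + 1)%N ==> (maxn (maxn a b) (maxn c d) == 6) ==>
    ((a, b, c, d) \in unimodular_max6)) r) r) r) r by vm_compute.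
move=> /eqP det1 max6; have mem_r (k : nat) : (k <= 6)%N -> k \in r.
  by rewrite mem_iota.
have : (maxn (maxn a b) (maxn c d) <= 6)%N by rewrite max6.
rewrite !geq_max => /andP[/andP[a6 b6] /andP[c6 d6]].
move/allP/(_ a (mem_r a a6))/allP/(_ b (mem_r b b6)): enumerated.
move/allP/(_ c (mem_r c c6))/allP/(_ d (mem_r d d6)).
by rewrite det1 max6.
Qed.

Section LatticeBound.
Variable R : realType.
Implicit Types (p q u v P Q : R * R).

Lemma pierces_box_basis_le p q (s t : R) (i j k l : nat) :
  0 <= p.1 -> 0 <= q.1 -> pierces_box (lattice p q) s t ->
  (i * l = j * k + 1)%N ->
  0 <= i%:R * p.2 + j%:R * q.2 -> k%:R * p.2 + l%:R * q.2 <= 0 ->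
  (i%:R * p.1 + j%:R * q.1) + (k%:R * p.1 + l%:R * q.1) <= s \/
  (i%:R * p.2 + j%:R * q.2) - (k%:R * p.2 + l%:R * q.2) <= t.
Proof.
move=> p1 q1 pierced det1 up down.
have := @straddling_box_le _ (p *+ i + q *+ j) (p *+ k + q *+ l) s t.
rewrite !nat_combE /=; apply; first by split; rewrite //= addr_ge0 ?mulr_ge0.
by rewrite -!nat_combE (@lattice_unimodular _ p q i j k l) //; lia.
Qed.

(* The matrices of [unimodular_max6] lead from [p], [q] to [P], [Q] in six steps
   of the Stern-Brocot tree; the basis after three steps is that of a missed
   box. *)
Lemma narrow_flat6_det_le p q P Q (a b c d : nat) :
  base_change p q P Q a b c d -> narrow_pair 1 6 p q -> flat_pair 6 1 P Q ->
  pierces_box (lattice p q) 3 3 -> - det2 p q <= 31 / 6.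
Proof.
move=> change narrow flat pierced; rewrite leNgt; apply/negP => large.
have max6 : maxn (maxn a b) (maxn c d) = 6%N.
  by apply: (largest_entry change _ narrow flat) => //; lra.
have pq_le0 : det2 p q <= 0 by case: narrow => /det2_straddling.
have pqD := ler0_norm pq_le0.
have [_ _ _ _ PQ_pq] := base_change_cramer change.
have tall : 31 / 6 < p.2 \/ 31 / 6 < - q.2.
  apply/orP; rewrite -lt_max; apply: lt_le_trans large _.
  by rewrite -pqD -[leRHS]mul1r; apply: narrow_pair_norm_det2_le narrow.
have wide : 31 / 6 < P.1 \/ 31 / 6 < Q.1.
  apply/orP; rewrite -lt_max; apply: lt_le_trans large _.
  by rewrite -pqD -PQ_pq -[leRHS]mul1r; apply: flat_pair_norm_det2_le flat.
have [P1E Q1E p2E q2E] := base_change_coords change.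
case: (narrow) (flat) => [[p1 q1 p2 q2] pq1 _ _] [[_ _ P2 Q2] _ _ PQ2].
have missed i j k l := @pierces_box_basis_le p q 3 3 i j k l p1 q1 pierced.
case: change => _ _ det1; have := mem_unimodular_max6 det1 max6; rewrite !inE.
case/or4P=> [/eqP|/eqP|/eqP|/or4P[/eqP|/eqP|/eqP|/orP[/eqP|/eqP]]];
  case=> aE bE cE dE;
  rewrite {det1 max6}aE bE cE dE in P1E Q1E p2E q2E.
- by have [] := missed 1 3 0 1 erefl; lra.
- by have [] := missed 1 1 2 3 erefl; lra.
- by have [] := missed 1 0 3 1 erefl; lra.
- by have [] := missed 3 2 1 1 erefl; lra.
- by have [] := missed 1 0 3 1 erefl; lra.
- by have [] := missed 3 2 1 1 erefl; lra.
- by have [] := missed 1 3 0 1 erefl; lra.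
- by have [] := missed 1 1 2 3 erefl; lra.
Qed.

Lemma pierced_lattice_det_le u v : pierces_box (lattice u v) 1 6 ->
  pierces_box (lattice u v) 6 1 -> pierces_box (lattice u v) 3 3 ->
  `|det2 u v| <= 31 / 6.
Proof.
move=> tall wide square; rewrite leNgt; apply/negP => large.
have [|||p [q [pq_uv narrow]]] := lattice_narrow_basis _ _ _ tall; [lra..|].
have [|||P [Q [PQ_uv flat]]] := lattice_flat_basis _ _ _ wide; [lra..|].
have pq_le0 : det2 p q <= 0 by case: narrow => /det2_straddling.
have pqE : - det2 p q = `|det2 u v|.
  by rewrite -ler0_norm // (lattice_norm_det2 pq_uv).
have [||a [b [c [d change]]]] := narrow_flat_base_change narrow flat.
- by rewrite PQ_uv pq_uv.
- by rewrite pqE; lra.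
suff : `|det2 u v| <= 31 / 6 by lra.
by rewrite -pqE; apply: narrow_flat6_det_le change narrow flat _; rewrite pq_uv.
Qed.

End LatticeBound.

Section Density.
Variable R : realType.

Lemma ecard_le_size (A : set (R * R)) (s : seq (R * R)) :
  (forall z, A z -> z \in s) -> (ecard A <= (size s)%:R%:E)%E.
Proof.
move=> As; have finA : finite_set A by apply: sub_finite_set (finite_seq s).
rewrite /ecard; case: pselect => // ?; rewrite lee_fin ler_nat.
apply: leq_trans (size_undup s); rewrite -card_fseq.
apply: fsubset_leq_card; apply/fsubsetP => z.
by rewrite in_fset_set // !inE => /As.
Qed.

Lemma density_le_of_ecard (P : set (R * R)) (c h : R) : 0 <= c -> 0 <= h ->
  (forall r : R, 0 < r ->
    (ecard (P `&` square r) <= (c * (2 * (r + h)) ^+ 2)%:E)%E) ->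
  (density P <= c%:E)%E.
Proof.
move=> c0 h0 count; apply/lee_addgt0Pr => eps eps0; rewrite -EFinD.
pose M : R := Num.max (h + 1) (3 * c * h / eps).
have M0 : 0 < M by rewrite lt_max; apply/orP; left; lra.
have inf_le : (density P <= ereal_sup [set (ecard (P `&` square r) *
    ((2 * r) ^+ 2)^-1%:E)%E | r in [set r : R | (M <= r)%R]])%E.
  by apply: ereal_inf_lbound; exists M.
apply: le_trans inf_le _; apply: ge_ereal_sup => _ [r /= Mr <-].
have hr : h + 1 <= r by apply: le_trans Mr; rewrite le_max lexx.
have chr : 3 * c * h <= eps * r.
  rewrite [eps * r]mulrC -ler_pdivrMr //; apply: le_trans Mr.
  by rewrite le_max lexx orbT.
have r0 : 0 < r by lra.
have rr : 0 < (2 * r) ^+ 2 by rewrite exprn_gt0 // mulr_gt0.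
apply: (@le_trans _ _ ((c * (2 * (r + h)) ^+ 2)%:E * ((2 * r) ^+ 2)^-1%:E)%E).
  by apply: lee_wpmul2r; [rewrite lee_fin invr_ge0 ltW|exact: count].
rewrite -EFinM lee_fin ler_pdivrMr // !expr2.
have chhr : c * h * h <= c * h * r by rewrite ler_wpM2l ?mulr_ge0 //; lra.
have : 3 * c * h * r <= eps * r * r by rewrite ler_pM2r.
lra.
Qed.

End Density.

Section PeriodicGraph.
Variables (R : realType) (N : nat) (s : nat -> nat).
Hypothesis N_gt0 : (0 < N)%N.

Definition periodic_graph : set (R * R) :=
  [set z | exists (i : nat) (k l : int), (i < N)%N /\
    z = ((N%:Z * k + i%:Z)%:~R, (N%:Z * l + (s i %% N)%N%:Z)%:~R)].

Lemma period_index (K : nat) (j : nat) (m : int) : (j < N)%N ->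
  - (N%:Z * K%:Z) < N%:Z * m + j%:Z -> N%:Z * m + j%:Z < N%:Z * K%:Z ->
  exists n : 'I_(2 * K), m = n%:Z - K%:Z.
Proof.
move=> jN lo hi; have nK : (absz (m + K%:Z)%R < 2 * K)%N by nia.
by exists (Ordinal nK) => /=; nia.
Qed.

Lemma ecard_periodic_graph (r : R) : 0 < r ->
  (ecard (periodic_graph `&` square r) <=
   (N%:R^-1 * (2 * (r + N%:R)) ^+ 2)%:E)%E.
Proof.
move=> r0; have N0 : 0 < N%:R :> R by rewrite ltr0n.
have rN0 : 0 <= r / N%:R by rewrite divr_ge0 // ltW.
pose K := (Num.truncn (r / N%:R)).+1.
have /andP[trunc_le rK] := truncn_itv rN0; rewrite -/K in rK.
have K_le : K%:R <= r / N%:R + 1 by rewrite -natr1 lerD2r.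
pose g (w : 'I_N * ('I_(2 * K) * 'I_(2 * K))) : R * R :=
  ((N%:Z * (w.2.1%:Z - K%:Z) + w.1%:Z)%:~R,
   (N%:Z * (w.2.2%:Z - K%:Z) + (s w.1 %% N)%N%:Z)%:~R).
have in_range z :
    (periodic_graph `&` square r) z -> z \in [seq g w | w in predT].
  move=> [[i [k [l [iN ->]]]] [/= zx zy]].
  have index (m : int) (j : nat) :
      (j < N)%N -> - r <= (N%:Z * m + j%:Z)%:~R <= r ->
      exists n : 'I_(2 * K), m = n%:Z - K%:Z.
    rewrite ltr_pdivrMr // in rK.
    move=> jN /andP[lo hi]; apply: (@period_index _ j) => //.
      rewrite -(ltr_int R); apply: lt_le_trans lo.
      by rewrite intrN intrM -!pmulrn ltrN2 mulrC.
    rewrite -(ltr_int R); apply: le_lt_trans hi _.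
    by rewrite intrM -!pmulrn mulrC.
  have sN : (s i %% N < N)%N by rewrite ltn_pmod.
  have [n ->] := index _ _ iN zx; have [n' ->] := index _ _ sN zy.
  by apply/mapP; exists (Ordinal iN, (n, n')); rewrite ?mem_enum.
apply: le_trans (ecard_le_size in_range) _.
rewrite size_map -cardE !card_prod !card_ord lee_fin !natrM.
have -> : N%:R^-1 * (2 * (r + N%:R)) ^+ 2 =
    N%:R * (2 * (r / N%:R + 1) * (2 * (r / N%:R + 1))).
  by field; rewrite lt0r_neq0.
by rewrite ler_pM2l // ler_pM ?mulr_ge0 // ler_pM2l.
Qed.

Lemma density_periodic_graph : (density periodic_graph <= (N%:R^-1)%:E)%E.
Proof.
by apply: density_le_of_ecard ecard_periodic_graph; rewrite ?invr_ge0.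
Qed.

Definition meets_windows (A B : nat) : bool :=
  all (fun i => all (fun j =>
    has (fun x => has (fun y => s ((i + x) %% N) == j + y %[mod N])%N
      (iota 0 B)) (iota 0 A)) (iota 0 N)) (iota 0 N).

Lemma meets_windows_shift (A B : nat) (m n : int) : meets_windows A B ->
  exists x y i : nat, exists k l : int,
    [/\ (x < A)%N, (y < B)%N, (i < N)%N &
        m + x%:Z = N%:Z * k + i%:Z /\ n + y%:Z = N%:Z * l + (s i %% N)%N%:Z].
Proof.
have residue (k : int) :
    exists (r : nat) (q : int), (r < N)%N /\ k = N%:Z * q + r%:Z.
  have N0 : N%:Z != 0 by lia.
  exists (absz (k %% N%:Z)%Z), (k %/ N%:Z)%Z; split.
    by have := ltz_mod k N0; have := modz_ge0 k N0; lia.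
  by rewrite mulrC gez0_abs ?modz_ge0 // -divz_eq.
have [i [k [iN ->]]] := residue m; have [j [l [jN ->]]] := residue n.
move=> /allP/(_ i); rewrite mem_iota => /(_ iN)/allP/(_ j).
rewrite mem_iota => /(_ jN)/hasP[x xA /hasP[y yB /eqP sE]].
rewrite !mem_iota /= !add0n in xA yB.
exists x, y, ((i + x) %% N)%N.
exists (k + ((i + x) %/ N)%N%:Z), (l + ((j + y) %/ N)%N%:Z); split=> //.
  exact: ltn_pmod.
by rewrite sE; have := divn_eq (i + x) N; have := divn_eq (j + y) N; split; nia.
Qed.

Lemma periodic_graph_pierces (A B : nat) :
  meets_windows A B -> pierces_box periodic_graph A%:R B%:R.
Proof.
move=> AB t; have [x [y [i [k [l [xA yB iN [xE yE]]]]]]] :=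
  meets_windows_shift (Num.ceil t.1) (Num.ceil t.2) AB.
exists ((N%:Z * k + i%:Z)%:~R, (N%:Z * l + (s i %% N)%N%:Z)%:~R).
  by exists i, k, l.
rewrite /= -xE -yE.
have inbox (e : R) (w W : nat) : (w < W)%N ->
    e <= (Num.ceil e + w%:Z)%:~R <= e + W%:R.
  move=> wW; have /andP[lo hi] := ceil_itv e.
  have wW' : w%:R + 1 <= W%:R :> R by rewrite natr1 ler_nat.
  have w0 : 0 <= w%:R :> R by [].
  by rewrite intrB in lo; rewrite intrD -pmulrn; lra.
by split; apply: inbox.
Qed.

End PeriodicGraph.

Definition out_shuffle6 : nat -> nat := nth 0%N [:: 0; 2; 4; 1; 3; 5]%N.

Section Boxes.
Variable R : realType.
Implicit Types a b c d : R.

Definition box a b : set (R * R) := closed_rect 0 0 a b.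

Lemma box_is_rect a b : 0 < a -> 0 < b -> is_rect (box a b).
Proof. by move=> a0 b0; exists 0, 0, a, b. Qed.

Lemma box_neq a b c d :
  0 <= a -> 0 <= b -> c < a \/ d < b -> box a b <> box c d.
Proof.
move=> a0 b0 lt boxE; have : box a b (a, b) by split; rewrite /= ?a0 ?b0 lexx.
by rewrite boxE => -[/= /andP[_ ac] /andP[_ bd]]; lra.
Qed.

Lemma translate_box a b t z : translate (box a b) t z <->
  t.1 <= z.1 <= t.1 + a /\ t.2 <= z.2 <= t.2 + b.
Proof.
split=> [[w [/andP[? ?] /andP[? ?]] <-]|[/andP[? ?] /andP[? ?]]] /=; first lra.
by exists (z - t); [split=> /=; lra|rewrite /= !subrK -surjective_pairing].
Qed.

Lemma pierces_boxP (L : set (R * R)) a b :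
  (forall t, exists2 z, L z & translate (box a b) t z) <-> pierces_box L a b.
Proof.
by split=> pierced t; have [z Lz /translate_box tz] := pierced t; exists z.
Qed.

Definition three_boxes : set (set (R * R)) :=
  [set A | A = box 1 6 \/ A = box 6 1 \/ A = box 3 3].

Lemma piercing_three_boxes (L : set (R * R)) : piercing three_boxes L <->
  [/\ pierces_box L 1 6, pierces_box L 6 1 & pierces_box L 3 3].
Proof.
split=> [pierced|[tall wide square] A [->|[->|->]]];
  [|exact/pierces_boxP..].
by split; apply/pierces_boxP; apply: pierced; [left|right; left|right; right].
Qed.

Lemma pi_dens_three_boxes_le : (pi_dens three_boxes <= (6^-1)%:E)%E.
Proof.
pose P := @periodic_graph R 6 out_shuffle6.
apply: le_trans (_ : density P <= _)%E; last exact: density_periodic_graph.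
apply: ereal_inf_lbound; exists P => //; apply/piercing_three_boxes; split.
- exact: (@periodic_graph_pierces _ 6 _ _ 1 6).
- exact: (@periodic_graph_pierces _ 6 _ _ 6 1).
- exact: (@periodic_graph_pierces _ 6 _ _ 3 3).
Qed.

Lemma piL_dens_three_boxes_ge : ((6 / 31 : R)%:E <= piL_dens three_boxes)%E.
Proof.
apply: le_ereal_inf_tmp => _ [[u v] /= [uv0 pierced] <-].
have [tall wide sq] := (piercing_three_boxes _).1 pierced.
rewrite lee_fin -[6 / 31]invf_div lef_pV2 ?posrE ?normr_gt0 ?divr_gt0 //.
exact: pierced_lattice_det_le.
Qed.

End Boxes.

Theorem theorem5 (R : realType) :
  exists A1 A2 A3 : set (R * R),
    [/\ is_rect A1, is_rect A2, is_rect A3 &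
        [/\ A1 <> A2, A1 <> A3 & A2 <> A3]] /\
    let F0 := [set A | A = A1 \/ A = A2 \/ A = A3] in
    ((36 / 31 : R)%:E * pi_dens F0 <= piL_dens F0)%E.
Proof.
exists (box 1 6), (box 6 1), (box 3 3); split.
  by split; [apply: box_is_rect..|split; apply: box_neq]; lra.
move=> F0; rewrite -[F0]/(@three_boxes R).
apply: le_trans (piL_dens_three_boxes_ge R).
rewrite (_ : (6 / 31)%:E = (36 / 31)%:E * (6^-1)%:E)%E; last first.
  by rewrite -EFinM; congr _%:E; field.
by apply: lee_wpmul2l (pi_dens_three_boxes_le R); rewrite lee_fin divr_ge0.
Qed.
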